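(* Let $\mathfrak{sl}_n\subset\mathfrak{sl}_m$ ($n<m$) be the canonical embedding over $\mathbb C$. Then the nilpotent orbits of $\mathfrak{sl}_m$ generated by the embedding elements for $\mathfrak{sl}_n$ in $\mathfrak{sl}_m$ are exactly the orbits of the Hasse subdiagram $\iota(H_{\mathfrak{sl}_{m-n+1}})$ of $H_{\mathfrak{sl}_m}$, where $\iota:\mathfrak{sl}_{m-n+1}\hookrightarrow\mathfrak{sl}_m$ is the canonical embedding.
   Context: Canonical embedding $\mathfrak{sl}_k\subset\mathfrak{sl}_m$: the one corresponding to a connected subdiagram of the $A_{m-1}$ Dynkin diagram containing an end point (e.g. the first $k-1$ nodes, i.e. $\mathfrak{sl}_k$ as upper-left block). Take diagonal Cartan subalgebras and standard bases, and triangular decompositions $\mathfrak n_i^-\oplus\mathfrak h_i\oplus\mathfrak n_i$ of $\mathfrak g_1=\mathfrak{sl}_n$ and $\mathfrak g_2=\mathfrak{sl}_m$, with $\mathfrak n_1\subset\mathfrak n_2$. For a positive root $\gamma$ of $\mathfrak g_2$ let $y_\gamma$ be a root vector for $-\gamma$. The element $y_\gamma$ is an embedding element for $\mathfrak g_1$ in $\mathfrak g_2$ if $\mathfrak n_1\cdot y_\gamma v^+=0$ for the highest weight vector $v^+$ of a $\mathfrak g_2$-Verma module (independently of its highest weight); for the embeddings considered here this is equivalent to $[\mathfrak n_1,y_\gamma]=0$. The nilpotent orbits generated by the embedding elements are the nilpotent orbits of $\mathfrak g_2$ that contain a linear combination of embedding elements. $H_{\mathfrak g}$ denotes the Hasse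 diagram of the nilpotent orbits of $\mathfrak g$. For an inclusion $\iota:\mathfrak g\hookrightarrow\mathfrak g_2$, $\iota(H_{\mathfrak g})$ is the Hasse subdiagram of $H_{\mathfrak g_2}$ consisting of those orbits that contain an element $\iota(X)$ with $X\in\mathfrak g$ nilpotent. *)

(* Defs.v *)
From HB Require Import structures.
From mathcomp Require Import all_boot all_order all_algebra.
From mathcomp Require Import boolp classical_sets topology normedtype.

Set Implicit Arguments.
Unset Strict Implicit.
Unset Printing Implicit Defensive.

Import GRing.Theory.
Import numFieldNormedType.Exports.

Local Open Scope classical_set_scope.
Local Open Scope ring_scope.

Section SpecialLinear.
Variables (K : numFieldType) (m : nat).
Implicit Types (X Y : 'M[K]_m) (O : set 'M[K]_m).

Definition lie_bracket X Y : 'M[K]_m := X *m Y - Y *m X.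

Definition sl : set 'M[K]_m := [set X | \tr X = 0].

Definition cartan : set 'M[K]_m := [set X | sl X /\ is_diag_mx X].

(* The strictly upper triangular matrices; the positive roots are the
   functionals H |-> H i i - H j j on the Cartan subalgebra, for i < j. *)
Definition npos : set 'M[K]_m :=
  [set X | forall i j : 'I_m, (j <= i)%N -> X i j = 0].

Definition root (i j : 'I_m) (H : 'M[K]_m) : K := H i i - H j j.

(* y is a root vector for the opposite of the root (i, j). *)
Definition neg_root_vector (i j : 'I_m) (y : 'M[K]_m) : Prop :=
  [/\ sl y, y != 0 &
      forall H, cartan H -> lie_bracket H y = - root i j H *: y].

Definition nilpotent X : Prop := exists k : nat, X ^+ k = 0.

(* Conjugation by GL_m: scalar matrices act trivially, so these are the orbits
   of the adjoint group PGL_m of sl_m. *)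
Definition adjoint_orbit X : set 'M[K]_m :=
  [set Y | exists2 g : 'M[K]_m, g \in unitmx & Y = g *m X *m invmx g].

Definition nilpotent_orbit O : Prop :=
  exists X, [/\ sl X, nilpotent X & O = adjoint_orbit X].

(* The action of X is only constrained for X in sl; the values of act at
   matrices of nonzero trace are irrelevant. *)
Definition sl_module (V : lmodType K) (act : 'M[K]_m -> V -> V) : Prop :=
  [/\ forall X (a : K) (u v : V), sl X ->
        act X (a *: u + v) = a *: act X u + act X v,
      forall (a : K) X Y (v : V), sl X -> sl Y ->
        act (a *: X + Y) v = a *: act X v + act Y v &
      forall X Y (v : V), sl X -> sl Y ->
        act (lie_bracket X Y) v = act X (act Y v) - act Y (act X v)].

(* A weight is the restriction to the Cartan subalgebra of a linear form on
   all matrices; every linear form on the Cartan subalgebra arises so.  The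
   vector v may be 0 here, as is convenient in the universal property below. *)
Definition highest_weight_vector (lam : {scalar 'M[K]_m}) (V : lmodType K)
    (act : 'M[K]_m -> V -> V) (v : V) : Prop :=
  (forall X, npos X -> act X v = 0) /\
  (forall H, cartan H -> act H v = lam H *: v).

Definition sl_module_morphism (V W : lmodType K)
    (actV : 'M[K]_m -> V -> V) (actW : 'M[K]_m -> W -> W)
    (f : {linear V -> W}) : Prop :=
  forall X v, sl X -> f (actV X v) = actW X (f v).

(* (V, act, v) is the Verma module of highest weight lam with its canonical
   generator, i.e. the universal highest weight module of weight lam. *)
Definition is_verma_module (lam : {scalar 'M[K]_m}) (V : lmodType K)
    (act : 'M[K]_m -> V -> V) (v : V) : Prop :=
  [/\ sl_module act,
      highest_weight_vector lam act v &
      forall (W : lmodType K) (actW : 'M[K]_m -> W -> W) (w : W),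
        sl_module actW -> highest_weight_vector lam actW w ->
        (exists f : {linear V -> W}, sl_module_morphism act actW f /\ f v = w)
        /\
        (forall f g : {linear V -> W},
            sl_module_morphism act actW f -> f v = w ->
            sl_module_morphism act actW g -> g v = w -> f =1 g)].

End SpecialLinear.

(* Which end point of the Dynkin diagram of type A_{m-1} the connected
   subdiagram of type A_{k-1} contains. *)
Inductive dynkin_end := FirstNode | LastNode.

Definition block_offset (e : dynkin_end) (k m : nat) : nat :=
  if e is FirstNode then 0 else m - k.

(* For k <= m, the canonical embedding of k x k matrices as a diagonal block,
   upper left for FirstNode and lower right for LastNode. *)
Definition canonical_embedding (K : numFieldType) (e : dynkin_end) (k m : nat)
    (X : 'M[K]_k) : 'M[K]_m :=
  \matrix_(i < m, j < m)
    \sum_(a < k) \sum_(b < k | (a + block_offset e k m == i)%N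
                            && (b + block_offset e k m == j)%N) X a b.

Arguments canonical_embedding : clear implicits.

Section EmbeddingElements.
Variables (K : numFieldType) (e : dynkin_end) (n m : nat).

Definition embedding_element (y : 'M[K]_m) : Prop :=
  (exists i j : 'I_m, (i < j)%N /\ neg_root_vector i j y) /\
  (forall (lam : {scalar 'M[K]_m}) (V : lmodType K)
      (act : 'M[K]_m -> V -> V) (v : V),
    is_verma_module lam act v ->
    forall x : 'M[K]_n, npos x ->
      act (canonical_embedding K e n m x) (act y v) = 0).

Definition embedding_combination (Y : 'M[K]_m) : Prop :=
  exists (N : nat) (c : 'I_N -> K) (y : 'I_N -> 'M[K]_m),
    (forall t, embedding_element (y t)) /\ Y = \sum_(t < N) c t *: y t.

Definition generated_orbits : set (set 'M[K]_m) :=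
  [set O | nilpotent_orbit O /\ exists2 Y, O Y & embedding_combination Y].

End EmbeddingElements.

Arguments generated_orbits : clear implicits.

Record diagram (T : Type) := Diagram {
  vertices : set T;
  edges : T -> T -> Prop }.

Definition subdiagram (T : Type) (H : diagram T) (S : set T) : diagram T :=
  Diagram (vertices H `&` S) (fun x y => [/\ edges H x y, S x & S y]).

Section Hasse.
Variable K : numFieldType.

Definition orbit_lt m (O1 O2 : set 'M[K]_m) : Prop :=
  O1 `<=` closure O2 /\ O1 <> O2.

Definition hasse m : diagram (set 'M[K]_m) :=
  Diagram (@nilpotent_orbit K m)
    (fun O1 O2 => [/\ nilpotent_orbit O1, nilpotent_orbit O2, orbit_lt O1 O2 &
       ~ exists O3, [/\ nilpotent_orbit O3, orbit_lt O1 O3 & orbit_lt O3 O2]]).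

Definition hasse_image (k m : nat) (iota : 'M[K]_k -> 'M[K]_m) :
    diagram (set 'M[K]_m) :=
  subdiagram (hasse m)
    [set O | exists X, [/\ sl X, nilpotent X & O (iota X)]].

End Hasse.

(* Main.v *)
Require Import Defs.
From HB Require Import structures.
From mathcomp Require Import all_boot all_order all_algebra.
From mathcomp Require Import fingroup perm generic_quotient.
From mathcomp Require Import spectral functions zify ring.
From mathcomp Require Import complex boolp classical_sets reals topology normedtype.

Set Implicit Arguments.
Unset Strict Implicit.
Unset Printing Implicit Defensive.

Import GRing.Theory Num.Theory.
Import numFieldNormedType.Exports.
Local Open Scope classical_set_scope.
Local Open Scope ring_scope.

(** Write E_pq for the matrix units and k for m - n + 1.  A root vector for the
    negative of the root (i, j), with i < j, is a nonzero multiple of E_ji.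
    Which of them are embedding elements is decided by the brackets of E_ji with
    the E_ab in n_1, because x . (y . v) = [x, y] . v when x kills the highest
    weight vector v.

    If [n_1, E_ji] = 0, then E_ji is an embedding element.  The E_ji with this
    property are exactly the strictly lower triangular units of the diagonal
    block of size k at the end opposite to sl_n.  For every other E_ji there is
    a simple root vector E_ab of sl_n, with a = i or b = j, such that
    E_ab . (E_ji . v) is nonzero in some Verma module ([verma_obstruction]).  As
    a Verma module maps to every module with a highest weight vector of the same
    weight, one such module in which the product does not vanish is enough.  The
    one used here is an oscillator representation: sl_m acts on formal power
    series in m variables through the operators x_p d_q, and exchanging the
    roles of x_q and d_q (up to sign) for all q in an initial segment makes the
    constant series 1 a highest weight vector.  Verma modules themselves are
    obtained from a term model ([verma_is_verma_module]).

    Hence the linear combinations of embedding elements are the strictly lower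
    triangular matrices of a diagonal block of size k
    ([embedding_combinationP]).  Such matrices are nilpotent, and by Schur
    triangularization every nilpotent k x k matrix is conjugate to one of them
    ([nilpotent_conj_strictly_lower]).  Conjugation in the block extends to
    GL_m, and the blocks at the two ends are conjugate by a cyclic permutation
    matrix ([canonical_embedding_conj], [canonical_embedding_ends]), so neither
    choice of end matters and the two sets of orbits agree. *)

(** * The Lie algebra sl_m, its modules and root vectors *)

Section SpecialLinearFacts.
Variables (K : numFieldType) (m : nat).

Lemma slD (a : K) (X Y : 'M[K]_m) : sl X -> sl Y -> sl (a *: X + Y).
Proof. by rewrite /sl /= mxtraceD mxtraceZ => -> ->; rewrite mulr0 addr0. Qed.

Lemma sl_lie_bracket (X Y : 'M[K]_m) : sl (lie_bracket X Y).
Proof. by rewrite /sl /= /lie_bracket raddfB /= mxtrace_mulC subrr. Qed.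

Lemma npos_sl (X : 'M[K]_m) : npos X -> sl X.
Proof. by move=> X0; rewrite /sl /= /mxtrace big1 // => i _; exact: X0. Qed.

Lemma delta_neq_sl (i j : 'I_m) : i != j -> sl (delta_mx i j : 'M[K]_m).
Proof.
move=> /negbTE ij; rewrite /sl /= /mxtrace big1 // => p _; rewrite mxE.
by have [-> | //] := eqVneq p i; rewrite ij.
Qed.

End SpecialLinearFacts.

Section SlModule.
Variables (K : numFieldType) (m : nat) (V : lmodType K).
Variables (act : 'M[K]_m -> V -> V) (actP : sl_module act).

Lemma sl_module0r X : sl X -> act X 0 = 0.
Proof.
move=> sX; have [lin _ _] := actP; have := lin X (-1) 0 0 sX.
by rewrite scaler0 addr0 scaleN1r addNr.
Qed.

Lemma sl_module0l v : act 0 v = 0.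
Proof.
have [_ lin _] := actP.
have s0 : sl (0 : 'M[K]_m) by rewrite /sl /= mxtrace0.
have := lin (-1) 0 0 v s0 s0.
by rewrite scaler0 addr0 scaleN1r addNr.
Qed.

Lemma sl_moduleZr X c v : sl X -> act X (c *: v) = c *: act X v.
Proof.
move=> sX; have [lin _ _] := actP.
by rewrite -[c *: v]addr0 lin // sl_module0r // addr0.
Qed.

Lemma sl_moduleZl X c v : sl X -> act (c *: X) v = c *: act X v.
Proof.
move=> sX; have [_ lin _] := actP.
have s0 : sl (0 : 'M[K]_m) by rewrite /sl /= mxtrace0.
by rewrite -[c *: X]addr0 lin // sl_module0l addr0.
Qed.

End SlModule.

Section RootVectors.
Variables (K : numFieldType) (m : nat).
Implicit Types (i j : 'I_m) (y X H : 'M[K]_m).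

Lemma lie_bracket_diagl H y a b : is_diag_mx H ->
  lie_bracket H y a b = (H a a - H b b) * y a b.
Proof.
move=> /is_diag_mxP dH; rewrite !mxE (bigD1 a) //= big1 ?addr0 => [|k ka].
  rewrite (bigD1 b) //= big1 ?addr0 => [|k kb]; last by rewrite dH ?mulr0.
  by rewrite mulrBl [y a b * _]mulrC.
by rewrite dH ?mul0r // eq_sym.
Qed.

Lemma lie_bracket_delta_eq0 i j X :
  (forall p, X p j = 0) -> (forall q, X i q = 0) ->
  lie_bracket X (delta_mx j i) = 0.
Proof.
move=> Xj Xi; apply/matrixP => p q; rewrite !mxE !big1 ?subrr // => r _.
  rewrite mxE; have [-> | _] := eqVneq r i; first by rewrite Xi mulr0.
  by rewrite andbF mul0r.
by rewrite mxE; have [-> | _] := eqVneq r j; rewrite ?Xj ?(mulr0, mul0r).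
Qed.

(** The coroot E_ii - E_jj alone isolates the root space: it acts on every E_ab
    by an integer between - 2 and 2, and by - 2 only on E_ji. *)
Lemma neg_root_vectorP i j y : (i < j)%N ->
  neg_root_vector i j y <-> exists2 c, c != 0 & y = c *: delta_mx j i.
Proof.
move=> ij; have nij : i != j by rewrite neq_ltn ij.
have ji := nij; rewrite eq_sym in ji.
split=> [[_ ny Hy] | [c c0 ->]].
  have y0 a b : (a, b) != (j, i) -> y a b = 0.
    move=> ab; pose d : 'rV[K]_m := \row_k ((k == i)%:R - (k == j)%:R).
    have dH : cartan (diag_mx d).
      split; last exact: diag_mx_is_diag.
      rewrite /sl /= mxtrace_diag.
      under eq_bigr => k _ do rewrite mxE.
      by rewrite sumrB -!natr_sum -!big_mkcond /= !big_pred1_eq subrr.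
    have /matrixP/(_ a b) := Hy _ dH.
    have -> : Defs.root i j (diag_mx d) = 2%:R.
      rewrite /Defs.root !mxE !eqxx (negbTE nij) (negbTE ji) !mulr1n.
      by rewrite subr0 sub0r opprK.
    rewrite lie_bracket_diagl ?diag_mx_is_diag // !mxE !eqxx !mulr1n => /eqP.
    rewrite -subr_eq0 -mulrBl mulf_eq0 => /orP[|/eqP //].
    (* The coefficient 2 + (t_a - t_b), where t is the diagonal of E_ii - E_jj,
       is a positive natural number, hence nonzero in characteristic 0. *)
    have le1 : ((a == j) + (b == i) <= 1)%N.
      by move: ab; rewrite xpair_eqE; case: (a == j); case: (b == i).
    have le2 : ((a == j) + (b == i) <= 2 + (a == i) + (b == j))%N.
      by rewrite -addnA (leq_trans le1) // ltnW // ltnS leq_addr.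
    have -> : (a == i)%:R - (a == j)%:R - ((b == i)%:R - (b == j)%:R) - - 2%:R
        = (2 + (a == i) + (b == j) - ((a == j) + (b == i)))%N%:R :> K.
      by rewrite natrB // !natrD; ring.
    rewrite pnatr_eq0 subn_eq0 => le3; move: (leq_trans le3 le1).
    by rewrite -addnA.
  exists (y j i); last first.
    apply/matrixP => a b; rewrite !mxE -xpair_eqE.
    by have [[-> ->] | /y0 ->] := eqVneq (a, b) (j, i); rewrite ?mulr1 ?mulr0.
  apply: contra ny => /eqP yji; apply/eqP/matrixP => a b; rewrite mxE.
  by have [[-> ->] | /y0 ->] := eqVneq (a, b) (j, i).
split.
- rewrite /sl /= mxtraceZ /mxtrace big1 ?mulr0 // => p _; rewrite mxE.
  by have [-> | //] := eqVneq p j; rewrite (negbTE ji).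
- apply/eqP => /matrixP/(_ j i); rewrite !mxE !eqxx mulr1; exact/eqP.
- move=> H [_ dH]; apply/matrixP => a b; rewrite lie_bracket_diagl // !mxE.
  have [-> | _] := eqVneq a j; last by rewrite !mulr0.
  have [-> | _] := eqVneq b i; last by rewrite !mulr0.
  by rewrite /root opprB.
Qed.

End RootVectors.

(** * Existence of Verma modules *)

Section VermaModule.
Variables (K : numFieldType) (m : nat) (lam : {scalar 'M[K]_m}).

(** The Verma module is built as a term model: formal expressions in a
    generator, identified when they agree in every module with a highest weight
    vector of weight [lam].  Every identity valid in all such modules then holds
    in the quotient, in particular the module axioms, and universality is
    evaluation of terms. *)
Inductive verma_term : Type :=
  | Gen
  | Zero
  | Add of verma_term & verma_term
  | Scale of K & verma_term
  | Act of 'M[K]_m & verma_term.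

HB.instance Definition _ := gen_eqMixin verma_term.
HB.instance Definition _ := gen_choiceMixin verma_term.

(** Matrices of nonzero trace act by 0 on terms, so that a morphism, which is
    constrained on sl only, is determined by its value at the generator. *)
Fixpoint eval (W : lmodType K) (act : 'M[K]_m -> W -> W) (w : W)
    (t : verma_term) : W :=
  match t with
  | Gen => w
  | Zero => 0
  | Add s t => eval act w s + eval act w t
  | Scale a t => a *: eval act w t
  | Act X t => if `[< sl X >] then act X (eval act w t) else 0
  end.

Definition term_equal (s t : verma_term) : Prop :=
  forall (W : lmodType K) (act : 'M[K]_m -> W -> W) (w : W),
    sl_module act -> highest_weight_vector lam act w ->
    eval act w s = eval act w t.

Definition term_eqb (s t : verma_term) : bool := `[< term_equal s t >].

Lemma term_eqb_equiv : equiv_class_of term_eqb.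
Proof.
split=> [s | s t | s r t].
- by apply/asboolP => W act w _ _.
- by apply/asboolP/asboolP => st W act w sW hw; rewrite (st W act w).
- move=> /asboolP rs /asboolP st; apply/asboolP => W act w sW hw.
  by rewrite (rs W act w sW hw) (st W act w sW hw).
Qed.

Canonical term_equiv := EquivRelPack term_eqb_equiv.

Definition verma := {eq_quot term_equiv}%qT.

HB.instance Definition _ := Choice.on verma.

Definition verma_class (t : verma_term) : verma := \pi_verma%qT t.

Definition value (W : lmodType K) (act : 'M[K]_m -> W -> W) (w : W)
    (x : verma) : W :=
  eval act w (repr x).

Lemma eval_repr (W : lmodType K) (act : 'M[K]_m -> W -> W) (w : W) x :
  eval act w (repr x) = value act w x.
Proof. by []. Qed.

Lemma value_class (W : lmodType K) (act : 'M[K]_m -> W -> W) (w : W) t :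
  sl_module act -> highest_weight_vector lam act w ->
  value act w (verma_class t) = eval act w t.
Proof.
move=> sW hw.
have /eqmodP/asboolP E : verma_class (repr (verma_class t)) = verma_class t.
  by rewrite /verma_class reprK.
exact: E.
Qed.

(** Equality in the quotient is tested by evaluation in all highest weight
    modules; the module axioms of [verma] are all proved this way. *)
Lemma verma_ext (x y : verma) :
  (forall (W : lmodType K) (act : 'M[K]_m -> W -> W) (w : W),
      sl_module act -> highest_weight_vector lam act w ->
      value act w x = value act w y) ->
  x = y.
Proof.
move=> xy; rewrite -[x]reprK -[y]reprK.
exact/eqmodP/asboolP.
Qed.

Definition verma_add (x y : verma) := verma_class (Add (repr x) (repr y)).
Definition verma_opp (x : verma) := verma_class (Scale (-1) (repr x)).
Definition verma_scale (a : K) (x : verma) := verma_class (Scale a (repr x)).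
Definition verma_act (X : 'M[K]_m) (x : verma) := verma_class (Act X (repr x)).

Ltac by_value lem :=
  apply: verma_ext => W act w sW hw;
  rewrite ?value_class //= !eval_repr ?value_class //= ?eval_repr lem.

Lemma verma_addA : associative verma_add.
Proof. by move=> x y z; by_value addrA. Qed.

Lemma verma_addC : commutative verma_add.
Proof. by move=> x y; by_value addrC. Qed.

Lemma verma_add0 : left_id (verma_class Zero) verma_add.
Proof. by move=> x; by_value add0r. Qed.

Lemma verma_addN : left_inverse (verma_class Zero) verma_opp verma_add.
Proof. by move=> x; by_value scaleN1r; rewrite addNr. Qed.

HB.instance Definition _ :=
  GRing.isZmodule.Build verma verma_addA verma_addC verma_add0 verma_addN.

Lemma verma_scaleA a b x :
  verma_scale a (verma_scale b x) = verma_scale (a * b) x.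
Proof. by by_value scalerA. Qed.

Lemma verma_scale1 : left_id 1 verma_scale.
Proof. by move=> x; by_value scale1r. Qed.

Lemma verma_scaleDr : right_distributive verma_scale +%R.
Proof. by move=> a x y; by_value scalerDr. Qed.

Lemma verma_scaleDl x : {morph verma_scale^~ x : a b / a + b}.
Proof. by move=> a b; by_value scalerDl. Qed.

HB.instance Definition _ :=
  GRing.Zmodule_isLmodule.Build K verma
    verma_scaleA verma_scale1 verma_scaleDr verma_scaleDl.

Section Value.
Variables (W : lmodType K) (act : 'M[K]_m -> W -> W) (w : W).
Hypotheses (sW : sl_module act) (hw : highest_weight_vector lam act w).

Lemma value_linear : linear (value act w).
Proof.
move=> a x y; rewrite -[LHS]/(value act w (verma_class _)) value_class //=.
by rewrite !eval_repr -[a *: x]/(verma_class _) value_class.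
Qed.

Lemma value_act X x : sl X ->
  value act w (verma_act X x) = act X (value act w x).
Proof. by move=> sX; rewrite value_class //= asboolT. Qed.

Lemma valueD x y : value act w (x + y) = value act w x + value act w y.
Proof. by rewrite -[x]scale1r value_linear !scale1r. Qed.

Lemma valueZ a x : value act w (a *: x) = a *: value act w x.
Proof.
have v0 : value act w 0 = 0 by rewrite value_class.
by rewrite -[a *: x]addr0 value_linear v0 addr0.
Qed.

Lemma valueB x y : value act w (x - y) = value act w x - value act w y.
Proof. by rewrite -scaleN1r valueD valueZ scaleN1r. Qed.

End Value.

Lemma verma_sl_module : sl_module verma_act.
Proof.
split=> [X a u v sX | a X Y v sX sY | X Y v sX sY];
  apply: verma_ext => W act w sW hw; have [actD addD brD] := sW.
- by rewrite value_linear // !value_act // value_linear // actD.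
- by rewrite value_linear // !value_act // ?addD //; exact: slD.
- rewrite valueB // !value_act // ?brD //; exact: sl_lie_bracket.
Qed.

Lemma verma_highest_weight :
  highest_weight_vector lam verma_act (verma_class Gen).
Proof.
split=> [X nX | H hH]; apply: verma_ext => W act w sW hw;
  have [w_npos w_cartan] := hw.
- by rewrite value_act ?value_class //= ?w_npos //; exact: npos_sl.
- by rewrite valueZ // value_act ?value_class //= ?w_cartan //; case: hH.
Qed.

Section Universality.
Variables (W : lmodType K) (act : 'M[K]_m -> W -> W) (w : W).
Hypotheses (sW : sl_module act) (hw : highest_weight_vector lam act w).

Lemma value_morphism_exists : exists f : {linear verma -> W},
  sl_module_morphism verma_act act f /\ f (verma_class Gen) = w.
Proof.
pose mixin := GRing.isLinear.Build K verma W *:%R _ (value_linear sW hw).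
pose f : {linear verma -> W} := HB.pack (value act w) mixin.
exists f; split; first by move=> X x sX; exact: value_act.
exact: value_class.
Qed.

Lemma verma_morphism_class (f : {linear verma -> W}) :
  sl_module_morphism verma_act act f -> f (verma_class Gen) = w ->
  forall t, f (verma_class t) = eval act w t.
Proof.
move=> fact fw; elim=> [| | s IHs t IHt | a t IHt | X t IHt] //=.
- by rewrite -(linear0 f).
- rewrite -IHs -IHt -linearD; congr (f _).
  by apply: verma_ext => U actU u sU hu; rewrite valueD // !value_class.
- rewrite -IHt -linearZ; congr (f _).
  by apply: verma_ext => U actU u sU hu; rewrite valueZ // !value_class.
- case: asboolP => sX.
    rewrite -IHt -fact //; congr (f _); apply: verma_ext => U actU u sU hu.
    by rewrite value_act // !value_class //= asboolT.
  rewrite -(linear0 f); congr (f _); apply: verma_ext => U actU u sU hu.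
  by rewrite !value_class //= asboolF.
Qed.

End Universality.

Theorem verma_is_verma_module : is_verma_module lam verma_act (verma_class Gen).
Proof.
split; [exact: verma_sl_module | exact: verma_highest_weight |].
move=> W act w sW hw; split; first exact: value_morphism_exists.
move=> f g fact fw gact gw x; rewrite -[x]reprK.
by rewrite (verma_morphism_class fact fw)
  (verma_morphism_class gact gw).
Qed.

End VermaModule.

(** * Oscillator representations *)

(** Operators A_i, B_j satisfying the canonical commutation relations represent
    matrices by quadratic operators, E_ij acting as A_i B_j; this is the usual
    realization of gl_m by x_i d_j, stated so that some of the pairs (x_i, d_i)
    may be replaced by (d_i, - x_i). *)
Section QuadraticAction.
Variables (K : numFieldType) (m : nat) (W : lmodType K).
Variables A B : 'I_m -> {linear W -> W}.

Definition quad_act (X : 'M[K]_m) (f : W) : W :=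
  \sum_i \sum_j X i j *: A i (B j f).

Hypothesis A_comm : forall i j f, A i (A j f) = A j (A i f).
Hypothesis B_comm : forall i j f, B i (B j f) = B j (B i f).
Hypothesis BA_comm : forall i j f, B i (A j f) = A j (B i f) + (i == j)%:R *: f.

Lemma quad_act_linear X : linear (quad_act X).
Proof.
move=> a f g; rewrite /quad_act scaler_sumr -big_split; apply: eq_bigr => i _.
rewrite scaler_sumr -big_split; apply: eq_bigr => j _ /=.
by rewrite !linearP.
Qed.

Lemma quad_act_linearl a X Y f :
  quad_act (a *: X + Y) f = a *: quad_act X f + quad_act Y f.
Proof.
rewrite /quad_act scaler_sumr -big_split; apply: eq_bigr => i _.
rewrite scaler_sumr -big_split; apply: eq_bigr => j _ /=.
by rewrite !mxE scalerDl scalerA.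
Qed.

(** The normally ordered part of the product of the operators of X and Y; being
    symmetric in X and Y, it cancels in the commutator. *)
Definition quad_sym (X Y : 'M[K]_m) (f : W) : W :=
  \sum_i \sum_j \sum_k \sum_l
    (X i j * Y k l) *: A i (A k (B j (B l f))).

Lemma quad_symC X Y f : quad_sym X Y f = quad_sym Y X f.
Proof.
rewrite /quad_sym.
under eq_bigr => i _ do rewrite exchange_big /=.
rewrite exchange_big /=; apply: eq_bigr => k _.
under eq_bigr => i _ do rewrite exchange_big /=.
rewrite exchange_big /=; apply: eq_bigr => l _.
apply: eq_bigr => i _; apply: eq_bigr => j _.
by rewrite A_comm B_comm mulrC.
Qed.

Lemma quad_act_comp X Y f :
  quad_act X (quad_act Y f) = quad_sym X Y f + quad_act (X *m Y) f.
Proof.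
have -> : quad_act (X *m Y) f =
    \sum_i \sum_j \sum_k \sum_l
      (X i j * Y k l * (j == k)%:R) *: A i (B l f).
  apply: eq_bigr => i _; rewrite [RHS]exchange_big /=.
  under [RHS]eq_bigr => k _ do rewrite exchange_big /=.
  rewrite [RHS]exchange_big /=; apply: eq_bigr => l _.
  rewrite mxE scaler_suml; apply: eq_bigr => k _.
  rewrite (bigD1 k) //= eqxx mulr1 big1 ?addr0 // => j /negbTE jk.
  by rewrite jk mulr0 scale0r.
rewrite /quad_sym /quad_act -big_split; apply: eq_bigr => i _ /=.
rewrite -big_split; apply: eq_bigr => j _ /=.
rewrite !linear_sum -big_split; apply: eq_bigr => k _ /=.
rewrite !linear_sum -big_split; apply: eq_bigr => l _ /=.
rewrite !linearZ /= BA_comm linearD (linearZ_LR (A i)) /=.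
by rewrite !scalerDr !scalerA (mulrC (Y k l)).
Qed.

Lemma quad_act_sl_module : sl_module quad_act.
Proof.
split=> [X a u v _ | a X Y v _ _ | X Y v _ _].
- exact: quad_act_linear.
- exact: quad_act_linearl.
- rewrite !quad_act_comp (quad_symC Y) opprD addrACA subrr add0r /lie_bracket.
  by rewrite [X *m Y - _]addrC -scaleN1r quad_act_linearl scaleN1r addrC.
Qed.

Lemma quad_act_delta i j f : quad_act (delta_mx i j) f = A i (B j f).
Proof.
rewrite /quad_act (bigD1 i) //= (bigD1 j) //= mxE !eqxx scale1r.
rewrite big1 => [|l /negbTE lj]; last by rewrite mxE lj andbF scale0r.
rewrite addr0 big1 ?addr0 // => k /negbTE ki; rewrite big1 // => l _.
by rewrite mxE ki scale0r.
Qed.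

End QuadraticAction.

Section Oscillator.
Variables (K : numFieldType) (m : nat).

Definition exponent := {ffun 'I_m -> nat}.
Definition fock := exponent -> K.
HB.instance Definition _ := GRing.Lmodule.on fock.

Implicit Types (i j : 'I_m) (al : exponent) (f g : fock).

Definition incr_exp i al : exponent := [ffun k => (al k + (k == i))%N].
Definition decr_exp i al : exponent := [ffun k => (al k - (k == i))%N].

(** The function f on exponents stands for the formal power series whose
    coefficient of x^al / al! is f al; this makes [deriv] a mere shift and puts
    the factor al i in [mulvar].  The truncated subtraction in [decr_exp] is
    harmless because that factor vanishes when al i = 0. *)
Definition deriv i f : fock := fun al => f (incr_exp i al).
Definition mulvar i f : fock := fun al => (al i)%:R * f (decr_exp i al).
Definition vacuum : fock := fun al => (al == [ffun=> 0%N])%:R.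

Lemma deriv_linear i : linear (deriv i).
Proof. by []. Qed.

HB.instance Definition _ i :=
  GRing.isLinear.Build K fock fock *:%R (deriv i) (deriv_linear i).

Lemma mulvar_linear i : linear (mulvar i).
Proof.
move=> a f g; apply/funext => al; rewrite /mulvar /=.
by rewrite [LHS]mulrDr mulrCA.
Qed.

HB.instance Definition _ i :=
  GRing.isLinear.Build K fock fock *:%R (mulvar i) (mulvar_linear i).

Lemma derivN i f : deriv i (- f) = - deriv i f.
Proof. exact: linearN. Qed.

Lemma mulvarN i f : mulvar i (- f) = - mulvar i f.
Proof. exact: linearN. Qed.

Lemma deriv0 i : deriv i 0 = 0.
Proof. exact: linear0. Qed.

Lemma mulvar0 i : mulvar i 0 = 0.
Proof. exact: linear0. Qed.

Lemma derivC i j f : deriv i (deriv j f) = deriv j (deriv i f).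
Proof.
apply/funext => al; rewrite /deriv; congr (f _).
by apply/ffunP => k; rewrite !ffunE addnAC.
Qed.

Lemma mulvarC i j f : mulvar i (mulvar j f) = mulvar j (mulvar i f).
Proof.
have [-> // | ij] := eqVneq i j.
apply/funext => al; rewrite /mulvar !ffunE (eq_sym j i) (negbTE ij) !subn0.
rewrite mulrCA; congr (_ * (_ * f _)).
by apply/ffunP => k; rewrite !ffunE subnAC.
Qed.

Lemma deriv_mulvar i j f :
  deriv i (mulvar j f) = mulvar j (deriv i f) + (i == j)%:R *: f.
Proof.
apply/funext => al.
rewrite -[RHS]/(mulvar j (deriv i f) al + (i == j)%:R * f al).
rewrite /deriv /mulvar !ffunE.
have [-> | ij] := eqVneq i j.
  rewrite mul1r addn1.
  have -> : decr_exp j (incr_exp j al) = al.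
    by apply/ffunP => k; rewrite !ffunE addnK.
  case E: (al j) => [|a]; first by rewrite mul1r mul0r add0r.
  have -> : incr_exp j (decr_exp j al) = al.
    apply/ffunP => k; rewrite !ffunE; have [-> | _] := eqVneq k j.
      by rewrite E subn1 addn1.
    by rewrite subn0 addn0.
  by rewrite -E -natr1 mulrDl mul1r.
rewrite addn0 mul0r addr0; congr (_ * f _).
apply/ffunP => k; rewrite !ffunE.
have [-> | _] := eqVneq k i; first by rewrite (negbTE ij) !subn0.
by rewrite !addn0.
Qed.

Lemma deriv_vacuum i : deriv i vacuum = 0.
Proof.
apply/funext => al; rewrite /deriv /vacuum.
by case: eqP => // /ffunP/(_ i); rewrite !ffunE eqxx addn1.
Qed.

Lemma vacuum_neq0 : vacuum != 0.
Proof.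
apply/eqP => /(congr1 (fun f : fock => f [ffun=> 0%N])).
by rewrite /vacuum eqxx; apply/eqP/oner_neq0.
Qed.

(** A series f killed by d_i is recovered as d_i (x_i f). *)
Lemma mulvar_neq0 i f : deriv i f = 0 -> f != 0 -> mulvar i f != 0.
Proof.
move=> dif; apply: contra_neq => xif.
have := deriv_mulvar i i f.
by rewrite xif dif eqxx scale1r deriv0 mulvar0 add0r.
Qed.

Variable c : pred 'I_m.

(** The partial Fourier transform: (x_i, d_i) becomes (d_i, - x_i) for the i
    satisfying [c]. *)
Definition osc_left i f : fock := if c i then deriv i f else mulvar i f.
Definition osc_right i f : fock := if c i then - mulvar i f else deriv i f.

Lemma osc_leftE i f : osc_left i f = if c i then deriv i f else mulvar i f.
Proof. by []. Qed.

Lemma osc_rightE i f : osc_right i f = if c i then - mulvar i f else deriv i f.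
Proof. by []. Qed.

Lemma osc_left_linear i : linear (osc_left i).
Proof. by move=> a f g; rewrite /osc_left; case: (c i); rewrite linearP. Qed.

Lemma osc_right_linear i : linear (osc_right i).
Proof.
move=> a f g; rewrite /osc_right; case: (c i); rewrite linearP //.
by rewrite opprD scalerN.
Qed.

HB.instance Definition _ i :=
  GRing.isLinear.Build K fock fock *:%R (osc_left i) (osc_left_linear i).
HB.instance Definition _ i :=
  GRing.isLinear.Build K fock fock *:%R (osc_right i) (osc_right_linear i).

Lemma osc_leftC i j f : osc_left i (osc_left j f) = osc_left j (osc_left i f).
Proof.
have [-> // | ij] := eqVneq i j; have ji := ij; rewrite eq_sym in ji.
rewrite /osc_left; case: (c i); case: (c j).
- exact: derivC.
- by rewrite deriv_mulvar (negbTE ij) scale0r addr0.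
- by rewrite deriv_mulvar (negbTE ji) scale0r addr0.
- exact: mulvarC.
Qed.

Lemma osc_rightC i j f :
  osc_right i (osc_right j f) = osc_right j (osc_right i f).
Proof.
have [-> // | ij] := eqVneq i j; have ji := ij; rewrite eq_sym in ji.
rewrite /osc_right; case: (c i); case: (c j).
- by rewrite !mulvarN mulvarC.
- by rewrite derivN deriv_mulvar (negbTE ji) scale0r addr0.
- by rewrite derivN deriv_mulvar (negbTE ij) scale0r addr0.
- exact: derivC.
Qed.

Lemma osc_right_left i j f :
  osc_right i (osc_left j f) = osc_left j (osc_right i f) + (i == j)%:R *: f.
Proof.
rewrite /osc_right /osc_left; have [-> | ij] := eqVneq i j.
  case: (c j); last by rewrite deriv_mulvar eqxx.
  by rewrite derivN deriv_mulvar eqxx scale1r opprD subrK.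
have ji := ij; rewrite eq_sym in ji; rewrite scale0r addr0.
case: (c i); case: (c j).
- by rewrite derivN deriv_mulvar (negbTE ji) scale0r addr0.
- by rewrite mulvarN mulvarC.
- exact: derivC.
- by rewrite deriv_mulvar (negbTE ij) scale0r addr0.
Qed.

Definition osc_act : 'M[K]_m -> fock -> fock := quad_act osc_left osc_right.

(** For [c i], the operator of E_ii is - d_i x_i, which maps the vacuum to its
    opposite; for the other i it is x_i d_i, which kills the vacuum. *)
Definition osc_weight (X : 'M[K]_m) : K := - \sum_(i | c i) X i i.

Lemma osc_weight_scalar : scalar osc_weight.
Proof.
move=> a X Y; rewrite /osc_weight mulrN mulr_sumr -opprD -big_split.
by congr (- _); apply: eq_bigr => i _; rewrite !mxE.
Qed.

HB.instance Definition _ :=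
  GRing.isLinear.Build K 'M[K]_m K *%R osc_weight osc_weight_scalar.

Lemma osc_act_delta i j f :
  osc_act (delta_mx i j) f = osc_left i (osc_right j f).
Proof. exact: quad_act_delta. Qed.

Lemma osc_sl_module : sl_module osc_act.
Proof.
apply: quad_act_sl_module; [exact: osc_leftC | exact: osc_rightC |].
exact: osc_right_left.
Qed.

(** Let i < j.  Unless [c j], the operator of E_ij applies d_j first, killing
    the vacuum; if [c j], then [c i] as well, and - d_i x_j kills the vacuum
    because i and j differ. *)
Lemma osc_highest_weight :
  (forall i j, (i < j)%N -> c j -> c i) ->
  highest_weight_vector osc_weight osc_act vacuum.
Proof.
move=> c_down; split=> [X nX | H [_ /is_diag_mxP dH]].
  apply: big1 => i _; apply: big1 => j _.
  have [ij | ji] := ltnP i j; last by rewrite nX // scale0r.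
  rewrite /= /osc_right; case: ifP => [cj | _]; last first.
    by rewrite deriv_vacuum linear0 scaler0.
  rewrite /osc_left (c_down _ _ ij cj) derivN deriv_mulvar deriv_vacuum.
  have /negbTE -> : i != j by rewrite neq_ltn ij.
  by rewrite mulvar0 scale0r addr0 oppr0 scaler0.
rewrite /osc_weight scaleNr scaler_suml -sumrN [in RHS]big_mkcond.
apply: eq_bigr => i _; rewrite (bigD1 i) //= big1 ?addr0 => [|j ji]; last first.
  by rewrite dH 1?eq_sym // scale0r.
rewrite /osc_right /osc_left; case: (c i); last first.
  by rewrite deriv_vacuum linear0 scaler0.
by rewrite derivN deriv_mulvar deriv_vacuum mulvar0 add0r eqxx scale1r scalerN.
Qed.

End Oscillator.

(** * Nonvanishing in Verma modules *)

Section Obstruction.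
Variables (K : numFieldType) (m : nat).
Implicit Types (i j a b : 'I_m) (f : fock K m).

Lemma deriv_mulvar_id i f : deriv i f = 0 -> deriv i (mulvar i f) = f.
Proof. by move=> dif; rewrite deriv_mulvar dif eqxx scale1r mulvar0 add0r. Qed.

Lemma deriv_mulvar_eq0 i j f :
  i != j -> deriv i f = 0 -> deriv i (mulvar j f) = 0.
Proof.
by move=> /negbTE ij dif; rewrite deriv_mulvar dif ij scale0r mulvar0 addr0.
Qed.

(** With the initial segment ending just before j, the vector E_ji . 1 is
    - x_j x_i; it is sent to x_b x_j by E_ib with b < j, and to - 1 by E_ij.  If
    instead b = j and i < a, the initial segment ending at i gives E_aj the form
    x_a d_j, which sends - x_j x_i to - x_a x_i. *)
Lemma osc_obstruction i j a b : (i < j)%N -> (a < b)%N ->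
  (a == i) && (b <= j)%N || (b == j) && (i <= a)%N ->
  exists2 c : pred 'I_m, (forall k l : 'I_m, (k < l)%N -> c l -> c k) &
    osc_act c (delta_mx a b) (osc_act c (delta_mx j i) (@vacuum K m)) != 0.
Proof.
move=> ij ab side; have nij : i != j by rewrite neq_ltn ij.
have ji := nij; rewrite eq_sym in ji.
have v0 := vacuum_neq0 K m; have dv := deriv_vacuum K (m := m).
have dxv k l : k != l -> deriv k (mulvar l (@vacuum K m)) = 0.
  by move=> kl; rewrite deriv_mulvar_eq0.
have [/andP[/eqP ai bj] | side'] := boolP ((a == i) && (b <= j)%N).
  exists (fun k : 'I_m => (k < j)%N) => [k l kl lj|]; first exact: ltn_trans lj.
  rewrite !osc_act_delta !(osc_leftE, osc_rightE) ai ij ltnn.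
  move: bj; rewrite leq_eqVlt => /orP[/eqP/val_inj -> | bj].
    rewrite ltnn ?(derivN, mulvarN) oppr_eq0 (deriv_mulvar_id (dxv _ _ ji)).
    by rewrite deriv_mulvar_id.
  have nib : i != b by rewrite neq_ltn -ai ab.
  have nbj : b != j by rewrite neq_ltn bj.
  rewrite bj ?(derivN, mulvarN) opprK (mulvarC j) (mulvarC b).
  rewrite deriv_mulvar_id; last by rewrite deriv_mulvar_eq0 // dxv.
  by apply: mulvar_neq0; [exact: dxv | apply: mulvar_neq0].
move: side; rewrite (negbTE side') /= => /andP[/eqP bj ia].
have nia : i != a.
  by apply: contraNneq side' => ->; rewrite bj eqxx leqnn.
have lia : (i < a)%N by rewrite ltn_neqAle nia.
exists (fun k : 'I_m => (k <= i)%N) => [k l kl li|].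
  exact/ltnW/(leq_trans kl).
have ani : (a <= i)%N = false by rewrite leqNgt lia.
have jni : (j <= i)%N = false by rewrite leqNgt ij.
rewrite !osc_act_delta !(osc_leftE, osc_rightE) bj leqnn ani jni.
rewrite ?(derivN, mulvarN) oppr_eq0 deriv_mulvar_id ?dxv //.
by apply: mulvar_neq0; [rewrite dxv 1?eq_sym | apply: mulvar_neq0].
Qed.

(** The Verma module maps onto the submodule of the oscillator module generated
    by the vacuum, so a product that is nonzero there is nonzero in the Verma
    module. *)
Lemma verma_obstruction i j a b : (i < j)%N -> (a < b)%N ->
  (a == i) && (b <= j)%N || (b == j) && (i <= a)%N ->
  exists (lam : {scalar 'M[K]_m}) (V : lmodType K)
    (act : 'M[K]_m -> V -> V) (v : V),
    is_verma_module lam act v /\ act (delta_mx a b) (act (delta_mx j i) v) <> 0.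
Proof.
move=> ij ab side; have [c c_down nz] := osc_obstruction ij ab side.
have sj : sl (delta_mx j i : 'M[K]_m).
  by apply: delta_neq_sl; rewrite neq_ltn ij orbT.
have sa : sl (delta_mx a b : 'M[K]_m).
  by apply: delta_neq_sl; rewrite neq_ltn ab.
exists (osc_weight c), (verma (osc_weight c)), (@verma_act _ _ _).
exists (verma_class _ (Gen _ _)); split; first exact: verma_is_verma_module.
have [f [fact fv]] :=
  value_morphism_exists (osc_sl_module K c) (osc_highest_weight K c_down).
by move=> E; move/eqP: nz; apply; rewrite -fv -!fact // E linear0.
Qed.

End Obstruction.

(** * Canonical embeddings *)

Section CanonicalEmbedding.
Variables (K : numFieldType) (e : dynkin_end) (k m : nat).

Local Notation off := (block_offset e k m).
Local Notation iota := (canonical_embedding K e k m).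

Definition block_incl : 'M[K]_(m, k) := \matrix_(i, a) ((a + off == i)%N)%:R.

Lemma canonical_embeddingE X : iota X = block_incl *m X *m block_incl^T.
Proof.
apply/matrixP => i j; rewrite /canonical_embedding !mxE.
under [RHS]eq_bigr => b _ do rewrite mxE mulr_suml.
rewrite [RHS]exchange_big; apply: eq_bigr => a _.
rewrite big_mkcond; apply: eq_bigr => b _; rewrite !mxE /=.
by do 2!case: eqP => _; rewrite ?(mul0r, mul1r, mulr0, mulr1).
Qed.

Lemma canonical_embedding_eq0 (X : 'M[K]_k) (i j : 'I_m) :
  (forall a b : 'I_k, (a + off)%N = i -> (b + off)%N = j -> X a b = 0) ->
  iota X i j = 0.
Proof.
move=> X0; rewrite mxE big1 // => a _; rewrite big1 // => b.
by case/andP => /eqP ai /eqP bj; rewrite X0.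
Qed.

Lemma canonical_embedding_delta (a b : 'I_k) (i j : 'I_m) :
  (a + off = i)%N -> (b + off = j)%N -> iota (delta_mx a b) = delta_mx i j.
Proof.
move=> ai bj; rewrite canonical_embeddingE.
have incl_delta (c : 'I_k) (p : 'I_m) : (c + off = p)%N ->
    block_incl *m delta_mx c 0 = delta_mx p (0 : 'I_1).
  move=> cp; apply/matrixP => q z; rewrite -colE !mxE cp (ord1 z) andbT.
  by rewrite eq_sym.
rewrite -[delta_mx a b](mul_delta_mx (0 : 'I_1)) mulmxA (incl_delta _ _ ai).
by rewrite -mulmxA -[delta_mx 0 b]trmx_delta -trmx_mul (incl_delta _ _ bj)
  trmx_delta mul_delta_mx.
Qed.

Lemma canonical_embeddingD X Y : iota (X + Y) = iota X + iota Y.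
Proof. by rewrite !canonical_embeddingE mulmxDr mulmxDl. Qed.

Lemma canonical_embeddingZ c X : iota (c *: X) = c *: iota X.
Proof. by rewrite !canonical_embeddingE -scalemxAr -scalemxAl. Qed.

Lemma canonical_embedding0 : iota 0 = 0.
Proof. by rewrite canonical_embeddingE mulmx0 mul0mx. Qed.

Lemma canonical_embedding_npos X : npos X -> npos (iota X).
Proof.
move=> nX i j ji; apply: canonical_embedding_eq0 => a b ai bj.
by apply: nX; rewrite -(leq_add2r off) ai bj.
Qed.

Lemma block_inclK : (k <= m)%N -> block_incl^T *m block_incl = 1%:M.
Proof.
move=> km; apply/matrixP => a b; rewrite !mxE.
have am : (a + off < m)%N.
  rewrite -[X in (_ < X)%N](subnKC km) /block_offset; case: (e).
    by rewrite addn0 (leq_trans (ltn_ord a)) // leq_addr.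
  by rewrite ltn_add2r.
rewrite (bigD1 (Ordinal am)) //= !mxE eqxx mul1r eqn_add2r.
rewrite big1 ?addr0 => [|i ia]; first by rewrite -val_eqE /= eq_sym.
rewrite !mxE; case: eqP => [ai | _]; last by rewrite mul0r.
by case/eqP: ia; apply: val_inj.
Qed.

(** With P the inclusion of the block, so that P^T P = 1, conjugation by g in
    the block extends to conjugation by P g P^T + (1 - P P^T), which is the
    identity on the complement of the block. *)
Lemma canonical_embedding_conj (g : 'M[K]_k) : (k <= m)%N -> g \in unitmx ->
  exists2 h : 'M[K]_m, h \in unitmx &
    forall X, iota (g *m X *m invmx g) = h *m iota X *m invmx h.
Proof.
move=> km gu; set P := block_incl; have PK := block_inclK km.
pose ext (u : 'M[K]_k) : 'M[K]_m := P *m u *m P^T + (1%:M - P *m P^T).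
have ext_incl u : ext u *m P = P *m u.
  rewrite mulmxDl mulmxBl mul1mx -!mulmxA PK !mulmx1.
  by rewrite subrr addr0.
have incl_ext u : P^T *m ext u = u *m P^T.
  rewrite mulmxDr mulmxBr mulmx1 !mulmxA PK !mul1mx.
  by rewrite subrr addr0.
have extM u v : ext u *m ext v = ext (u *m v).
  rewrite {2}/ext mulmxDr mulmxBr mulmx1 !mulmxA !ext_incl.
  by rewrite /ext mulmxA; congr (_ + _); rewrite addrAC subrr add0r.
have ext1 : ext 1%:M = 1%:M by rewrite /ext mulmx1 addrC subrK.
have hu : ext g *m ext (invmx g) = 1%:M by rewrite extM mulmxV.
have [u1 _] := mulmx1_unit hu.
exists (ext g) => // X.
have -> : invmx (ext g) = ext (invmx g).
  by rewrite -[LHS]mulmx1 -hu mulKmx.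
rewrite !canonical_embeddingE -/P !mulmxA ext_incl -!mulmxA incl_ext.
by rewrite !mulmxA.
Qed.

End CanonicalEmbedding.

(** The cyclic rotation of the indices by m - k carries the upper left block
    onto the lower right one. *)
Lemma canonical_embedding_ends (K : numFieldType) (e e' : dynkin_end)
    (k m : nat) : (0 < k <= m)%N ->
  exists2 s : 'M[K]_m, s \in unitmx &
    forall X, canonical_embedding K e' k m X =
      s *m canonical_embedding K e k m X *m invmx s.
Proof.
move=> /andP[k0 km].
suff [s su E] : exists2 s : 'M[K]_m, s \in unitmx &
    forall X, canonical_embedding K LastNode k m X =
      s *m canonical_embedding K FirstNode k m X *m invmx s.
  case: e; case: e'.
  - by exists 1%:M => [|X]; rewrite ?unitmx1 // invmx1 mulmx1 mul1mx.
  - by exists s.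
  - exists (invmx s) => [|X]; first by rewrite unitmx_inv.
    by rewrite E invmxK -!mulmxA mulVmx // mulmx1 mulmxA mulVmx // mul1mx.
  - by exists 1%:M => [|X]; rewrite ?unitmx1 // invmx1 mulmx1 mul1mx.
case: m km => [|m] km; first by case: k k0 km.
pose r : 'I_m.+1 := inord (m.+1 - k).
pose t : 'S_m.+1 := perm (addrI r).
have sE : perm_mx t^-1 *m block_incl K FirstNode k m.+1
    = block_incl K LastNode k m.+1.
  apply/matrixP => i a; rewrite -row_permE !mxE /= addn0.
  congr (nat_of_bool _)%:R.
  have [j ->] : exists j, i = t j by exists (t^-1%g i); rewrite permKV.
  rewrite permK; pose a' : 'I_m.+1 := widen_ord km a.
  have <- : t a' = (a + (m.+1 - k))%N :> nat.
    rewrite permE /= inordK; last by rewrite ltn_subrL k0.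
    rewrite modn_small; last by rewrite -ltn_subRL subKn.
    exact: addnC.
  by rewrite [RHS](inj_eq val_inj) (inj_eq perm_inj) -(inj_eq val_inj).
exists (perm_mx t^-1) => [|X]; first exact: unitmx_perm.
rewrite !canonical_embeddingE -sE trmx_mul tr_perm_mx.
have -> : invmx (perm_mx t^-1) = perm_mx (t^-1)^-1 :> 'M[K]_m.+1.
  have uP : (perm_mx t^-1 : 'M[K]_m.+1) \in unitmx by exact: unitmx_perm.
  by rewrite -[LHS]mulmx1 -(perm_mx1 K) -(mulgV t^-1%g) perm_mxM mulKmx.
by rewrite !mulmxA.
Qed.

(** * Classification of the embedding elements *)

Definition opposite_end (e : dynkin_end) : dynkin_end :=
  if e is FirstNode then LastNode else FirstNode.

Section EmbeddingElements.
Variables (K : numFieldType) (e : dynkin_end) (n m : nat).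
Hypotheses (n_gt0 : (0 < n)%N) (n_lt_m : (n < m)%N).

Local Notation k := (m - n + 1)%N.
Local Notation iota' := (canonical_embedding K (opposite_end e) k m).

Lemma commuting_embedding_element (i j : 'I_m) (y : 'M[K]_m) : (i < j)%N ->
  neg_root_vector i j y ->
  (forall x : 'M[K]_n, npos x ->
    lie_bracket (canonical_embedding K e n m x) y = 0) ->
  embedding_element e n y.
Proof.
move=> ij yroot comm; split; first by exists i, j.
move=> lam V act v [actP [v_npos _] _] x nx.
have [sy _ _] := yroot; have nX := canonical_embedding_npos e (m := m) nx.
have [_ _ /(_ _ y v (npos_sl nX) sy)] := actP.
by rewrite (comm x nx) sl_module0l // (v_npos _ nX) sl_module0r // subr0 => <-.
Qed.

(** If the bound fails, then the simple root vector E_(i,i+1) (with sl_n at the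
    first node), respectively E_(j-1,j) (at the last node), belongs to sl_n and
    sends E_ji . v to a nonzero vector in some Verma module. *)
Lemma embedding_element_bounds (i j : 'I_m) c : (i < j)%N -> c != 0 ->
  embedding_element e n (c *: delta_mx j i : 'M[K]_m) ->
  if e is FirstNode then (n <= i.+1)%N else (j <= m - n)%N.
Proof.
move=> ij c0 [_ killed].
have sji : sl (delta_mx j i : 'M[K]_m).
  by apply: delta_neq_sl; rewrite neq_ltn ij orbT.
suff clash (a' b' : 'I_n) (a b : 'I_m) : (a < b)%N ->
    (a' + block_offset e n m)%N = a -> (b' + block_offset e n m)%N = b ->
    (a == i) && (b <= j)%N || (b == j) && (i <= a)%N -> False.
  case E: e; rewrite E in clash; rewrite leqNgt; apply/negP => bad.
    have ni : (i < n)%N by exact: ltnW.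
    have i1m : (i.+1 < m)%N by exact: leq_ltn_trans ij (ltn_ord j).
    apply: (clash (Ordinal ni) (Ordinal bad) i (Ordinal i1m)) => //=;
      rewrite ?addn0 //.
    by rewrite eqxx ij.
  have j0 : (0 < j)%N by exact: leq_ltn_trans ij.
  have jE : j = j.-1.+1 :> nat by rewrite prednK.
  have ij1 : (i <= j.-1)%N by rewrite -ltnS -jE.
  have lej : (m - n <= j.-1)%N by rewrite -ltnS -jE.
  have bn : (j - (m - n) < n)%N.
    by rewrite ltn_subLR ?subnK ?ltn_ord // ltnW.
  have an : (j.-1 - (m - n) < n)%N.
    by apply: leq_ltn_trans bn; rewrite leq_sub2r // leq_pred.
  have am : (j.-1 < m)%N by apply: leq_ltn_trans (ltn_ord j); exact: leq_pred.
  apply: (clash (Ordinal an) (Ordinal bn) (Ordinal am) j) => //=.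
  - by rewrite prednK.
  - by rewrite subnK.
  - by rewrite subnK // ltnW.
  - by rewrite eqxx ij1 orbT.
move=> ab ai bj side.
have [lam [V [act [v [verm]]]]] := verma_obstruction K ij ab side; apply.
have [actP _ _] := verm.
have sab : sl (delta_mx a b : 'M[K]_m).
  by apply: delta_neq_sl; rewrite neq_ltn ab.
have nx : npos (delta_mx a' b' : 'M[K]_n).
  move=> p q qp; rewrite mxE; case: eqP => // pa; case: eqP => // qb.
  by move: ab; rewrite -ai -bj ltn_add2r ltnNge -pa -qb qp.
have := killed _ _ _ _ verm _ nx.
rewrite (canonical_embedding_delta K ai bj) sl_moduleZl // sl_moduleZr //.
by move/eqP; rewrite scaler_eq0 (negbTE c0) => /eqP.
Qed.

(** The bracket of n_1 with E_ji involves only the row i and the column j of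
    elements of n_1.  These vanish for i < j in the complementary block: it
    shares a single index with the block of sl_n, the last one of sl_n at the
    first node, where only i can be and where the rows of n_1 are zero, or the
    first one of sl_n at the last node, where only j can be and where the
    columns of n_1 are zero. *)
Lemma embedding_elementP (y : 'M[K]_m) :
  embedding_element e n y <->
  exists a b : 'I_k, (a < b)%N /\
    exists2 c, c != 0 & y = c *: iota' (delta_mx b a).
Proof.
have offE : (if e is FirstNode then n.-1 else 0)%N
    = block_offset (opposite_end e) k m.
  case: (e) => //=; rewrite subnDA subKn ?subn1 //; exact: ltnW.
have kE : k = (m - n).+1 by rewrite addn1.
split=> [emb | [a [b [ab [c c0 ->]]]]].
  have [[i [j [ij /(neg_root_vectorP _ ij) [c c0 yE]]]] _] := emb.
  rewrite yE in emb; have bnd := embedding_element_bounds ij c0 emb.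
  pose off := block_offset (opposite_end e) k m.
  have oi : (off <= i)%N.
    by rewrite /off -offE; move: bnd; case: (e) => //; case: (n) n_gt0.
  have jk : (j - off < k)%N.
    rewrite /off -offE kE ltnS; move: bnd; case: (e); last by rewrite subn0.
    move=> _; rewrite leq_subLR -ltnS (leq_trans (ltn_ord j)) //.
    by rewrite -addSn prednK // subnKC // ltnW.
  have ik : (i - off < k)%N.
    by apply: leq_ltn_trans jk; rewrite leq_sub2r // ltnW.
  exists (Ordinal ik), (Ordinal jk); split.
    by rewrite /= ltn_sub2r // (leq_ltn_trans oi).
  exists c => //; rewrite yE; congr (_ *: _); symmetry.
  apply: canonical_embedding_delta; rewrite /= subnK //.
  by rewrite (leq_trans oi) // ltnW.
have offlt (d : 'I_k) : (d + block_offset (opposite_end e) k m < m)%N.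
  have dn : (d <= m - n)%N by rewrite -ltnS -kE.
  rewrite -offE; case: (e).
    apply: (@leq_ltn_trans (m - n + n.-1)); first by rewrite leq_add2r.
    by rewrite -addnS prednK // subnK // ltnW.
  rewrite addn0 (leq_ltn_trans dn) // ltn_subrL n_gt0.
  exact: leq_ltn_trans n_lt_m.
pose i := Ordinal (offlt a); pose j := Ordinal (offlt b).
have ij : (i < j)%N by rewrite /= ltn_add2r.
rewrite (@canonical_embedding_delta _ _ _ _ b a j i) //.
apply: (commuting_embedding_element ij) => [|x nx].
  by apply/neg_root_vectorP => //; exists c.
rewrite /lie_bracket -scalemxAr -scalemxAl -scalerBr.
rewrite -/(lie_bracket _ _) lie_bracket_delta_eq0 ?scaler0 // => [p | q].
all: apply: canonical_embedding_eq0 => p' q' /=; rewrite -offE => pi qj.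
all: have := ltn_ord p'; have := ltn_ord q'; have := ltn_ord a.
all: have := ltn_ord b; move=> bk ak qn pn; apply: nx.
all: move: pi qj; case: (e) => /= pi qj; lia.
Qed.

End EmbeddingElements.

(** * Nilpotent matrices and strictly lower triangular matrices *)

Definition strictly_lower (K : numFieldType) k (L : 'M[K]_k) : Prop :=
  forall i j : 'I_k, (i <= j)%N -> L i j = 0.

Lemma strictly_lower_sl (K : numFieldType) k (L : 'M[K]_k) :
  strictly_lower L -> sl L.
Proof. by move=> L0; rewrite /sl /= /mxtrace big1 // => i _; exact: L0. Qed.

(** The characteristic polynomial is X^k, so this is Cayley-Hamilton. *)
Lemma strictly_lower_nilpotent (K : numFieldType) k (L : 'M[K]_k) :
  strictly_lower L -> Defs.nilpotent L.
Proof.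
case: k L => [|p] L L0; first by exists 0%N; apply/matrixP => -[].
exists p.+1; have := Cayley_Hamilton L.
rewrite char_poly_trig; last first.
  by apply/is_trig_mxP => i j ij; apply: L0; exact: ltnW.
under eq_bigr => i _ do rewrite L0 // subr0.
by rewrite prodr_const card_ord rmorphXn /= horner_mx_X.
Qed.

(** Schur triangularization; the diagonal of the triangular form consists of
    nilpotent scalars. *)
Lemma nilpotent_conj_strictly_lower (C : numClosedFieldType) k (X : 'M[C]_k) :
  Defs.nilpotent X ->
  exists2 g : 'M[C]_k, g \in unitmx & strictly_lower (g *m X *m invmx g).
Proof.
case: k X => [|k] X [p Xp]; first by exists 1%:M => [|[]//]; exact: unitmx1.
have [g /unitarymx_unit gu] := Schur X (ltn0Sn k).
rewrite /similar_to conjumx // => /is_trig_mxP trig.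
exists g => // i j.
rewrite leq_eqVlt => /orP[/eqP/val_inj <-|]; last exact: trig.
set L := g *m X *m invmx g in trig *.
have Lp : L ^+ p = 0.
  have powE q : L ^+ q = g *m X ^+ q *m invmx g.
    elim: q => [|q IH]; first by rewrite !expr0 mulmx1 mulmxV.
    rewrite !exprS IH -!mulmxE /L -!mulmxA; congr (_ *m (_ *m _)).
    by rewrite mulKmx.
  by rewrite powE Xp mulmx0 mul0mx.
have trigX q : is_trig_mx (L ^+ q) /\ (L ^+ q) i i = L i i ^+ q.
  elim: q => [|q [/is_trig_mxP tq IH]].
    by rewrite !expr0 scalar_mx_is_trig mxE eqxx.
  split; rewrite exprS -mulmxE.
    apply/is_trig_mxP => a b ab; rewrite mxE big1 // => c _.
    have [ac | ca] := ltnP a c; first by rewrite trig ?mul0r.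
    by rewrite tq ?mulr0 // (leq_ltn_trans ca).
  rewrite mxE (bigD1 i) //= big1 ?addr0 ?IH -?exprS // => c ci.
  have [ic | ] := ltnP i c; first by rewrite trig ?mul0r.
  by rewrite leq_eqVlt val_eqE (negbTE ci) /= => ci'; rewrite tq ?mulr0.
have [_] := trigX p; rewrite Lp mxE => /esym/eqP.
by rewrite expf_eq0 => /andP[_ /eqP].
Qed.

Lemma nilpotent_orbit_conj (K : numFieldType) m (O : set 'M[K]_m)
    (g A : 'M[K]_m) :
  nilpotent_orbit O -> g \in unitmx -> O A -> O (g *m A *m invmx g).
Proof.
move=> [X [_ _ ->]] gu [h hu ->].
have ghu : g *m h \in unitmx by rewrite unitmx_mul gu.
exists (g *m h) => //; rewrite -(mulmxK ghu (_ *m _ *m invmx g)).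
congr (_ *m _).
by rewrite !mulmxA mulmxKV // mulmxKV.
Qed.

(** * Combinations of embedding elements *)

Section Combinations.
Variables (K : numFieldType) (e : dynkin_end) (n m : nat).
Hypotheses (n_gt0 : (0 < n)%N) (n_lt_m : (n < m)%N).

Local Notation k := (m - n + 1)%N.
Local Notation iota' := (canonical_embedding K (opposite_end e) k m).

Lemma embedding_combinationP (Y : 'M[K]_m) :
  embedding_combination e n Y <->
  exists2 L : 'M[K]_k, strictly_lower L & Y = iota' L.
Proof.
split=> [[N [c [y [emb ->]]]] | [L L0 ->]].
  apply: (big_ind (fun Z => exists2 L, strictly_lower L & Z = iota' L)).
  - by exists 0; rewrite ?canonical_embedding0 // => i j _; rewrite mxE.
  - move=> _ _ [L1 low1 ->] [L2 low2 ->]; exists (L1 + L2).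
      by move=> i j ij; rewrite mxE low1 ?low2 ?addr0.
    by rewrite canonical_embeddingD.
  - move=> t _; have [a [b [ab [d d0 ->]]]] :=
      (embedding_elementP e n_gt0 n_lt_m (y t)).1 (emb t).
    exists (c t *: (d *: delta_mx b a)); last by rewrite !canonical_embeddingZ.
    move=> i j ij; rewrite !mxE; case: eqP => [ib|]; last by rewrite !mulr0.
    case: eqP => [ja|]; last by rewrite !mulr0.
    by move: ij; rewrite ib ja leqNgt ab.
pose P := [pred p : 'I_k * 'I_k | (p.2 < p.1)%N].
exists #|P|, (fun t => L (enum_val t).1 (enum_val t).2).
exists (fun t => iota' (delta_mx (enum_val t).1 (enum_val t).2)); split.
  move=> t; apply/embedding_elementP => //.
  exists (enum_val t).2, (enum_val t).1; split; first exact: (enum_valP t).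
  by exists 1; rewrite ?oner_neq0 ?scale1r.
rewrite -(big_enum_val (A := P)
  (fun p => L p.1 p.2 *: iota' (delta_mx p.1 p.2))).
rewrite [in LHS](matrix_sum_delta L) pair_big /=.
rewrite (big_morph _ (@canonical_embeddingD _ _ _ _)
  (@canonical_embedding0 _ _ _ _)).
rewrite [RHS]big_mkcond; apply: eq_bigr => -[a b] _.
rewrite canonical_embeddingZ /=.
case: ifPn => //; rewrite inE -leqNgt => ab; by rewrite L0 ?scale0r.
Qed.

End Combinations.

(* [e1] and [e2] are the end points of the Dynkin diagram used by the two
   canonical embeddings. *)
Theorem theorem5p5 (R : realType) (n m : nat) (e1 e2 : dynkin_end)
  (n_gt0 : (0 < n)%N) (n_lt_m : (n < m)%N) :
  generated_orbits R[i] e1 n m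
  = vertices (hasse_image (canonical_embedding R[i] e2 (m - n + 1) m)).
Proof.
have km : (m - n + 1 <= m)%N by rewrite addn1 ltn_subrL n_gt0 (ltn_trans n_gt0).
have k_gt0 : (0 < m - n + 1 <= m)%N by rewrite addn1 /= -addn1.
apply/seteqP; split => O [orbO].
  move=> [Y OY /(embedding_combinationP e1 n_gt0 n_lt_m) [L low YE]].
  split=> //; exists L; split; first exact: strictly_lower_sl.
    exact: strictly_lower_nilpotent.
  have [s su ->] := canonical_embedding_ends R[i] (opposite_end e1) e2 k_gt0.
  by apply: nilpotent_orbit_conj; rewrite -?YE.
move=> [X [_ nilX OX]]; split=> //.
have [g gu low] := nilpotent_conj_strictly_lower nilX.
have [h hu hE] := canonical_embedding_conj (opposite_end e1) km gu.
have [s su sE] := canonical_embedding_ends R[i] e2 (opposite_end e1) k_gt0.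
exists (canonical_embedding R[i] (opposite_end e1) (m - n + 1) m
          (g *m X *m invmx g)).
  by rewrite hE sE; do 2!apply: nilpotent_orbit_conj => //.
by apply/embedding_combinationP => //; exists (g *m X *m invmx g).
Qed.
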